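(* Let $K\ge 2$, let $a\in\mathcal P(\{0,1\}^K)$ and let $m\in\mathcal P(\mathbb R^K)$. For $i\in[K]$ and $y\in\{i,-i\}$, let $l(m,a,y)$ denote the conditional law of $X+\Delta X$ given $Y=y$ in the one-round model described in the context (where $X\sim m$). Then, for every $i\in[K]$, $$l(m,a,i)=\sum_{j\subset[K]:\, i\in j}\left(\frac{a(j)}{\hat a(i)}\,m\right)_{\sharp\,-e_{j^c}}\quad\text{whenever }\hat a(i)>0,$$ $$l(m,a,-i)=\sum_{j\subset[K]:\, i\notin j}\left(\frac{a(j)}{\hat a(-i)}\,m\right)_{\sharp\, e_{j}}\quad\text{whenever }\hat a(-i)>0,$$ with the convention that $l(m,a,y)=\delta_{\mathbf 0}$ whenever $\hat a(y)=0$.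
   Context: Notation: $[K]=\{1,\dots,K\}$; $\mathcal P(E)$ is the set of probability measures on $E$; elements of $\{0,1\}^K$ are identified with subsets $j\subset[K]$, and $j^c=[K]\setminus j$. $e_1,\dots,e_K$ is the canonical basis of $\mathbb R^K$, $e_j=\sum_{i\in j}e_i$ for $j\subset[K]$, and $e=\sum_{i=1}^K e_i$. For a finite measure $\mu$ on $\mathbb R^K$ and $v\in\mathbb R^K$, $\mu_{\sharp v}$ is the translate of $\mu$ by $v$: $\int f(x)\,\mu_{\sharp v}(dx)=\int f(x+v)\,\mu(dx)$ for bounded continuous $f$. For $a\in\mathcal P(\{0,1\}^K)$ and $i\in[K]$, $$\hat a(i)=\sum_{j:\,i\in j}a(j),\qquad \hat a(-i)=\sum_{j:\,i\notin j}a(j).$$ One-round model: let $b\in\mathcal P([K])$ and let $X,I,J$ be independent with $X\sim m$ (values in $\mathbb R^K$), $I\sim b$ (values in $[K]$), $J\sim a$ (values in the subsets of $[K]$). Set $\Delta X=e_J-\mathbf 1_{\{I\in J\}}\,e$, and $Y=I$ if $I\in J$, $Y=-I$ if $I\notin J$. For $y\in\{i,-i\}$ with $\hat a(y)>0$, $l(m,a,y)$ is the conditional law of $X+\Delta X$ given $\{Y=y\}$, computed for any $b$ with $b(i)>0$ (so that $\{Y=y\}$ has positive probability); it is part of the assertion that it does not depend on such $b$. *)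

(* Defs.v *)
From HB Require Import structures.
From mathcomp Require Import all_boot all_order all_algebra.
From mathcomp Require Import all_classical all_reals all_analysis.

Set Implicit Arguments.
Unset Strict Implicit.
Unset Printing Implicit Defensive.

Import Order.TTheory GRing.Theory Num.Theory.
Import numFieldNormedType.Exports.

Local Open Scope classical_set_scope.
Local Open Scope ring_scope.

(* Borel sigma-algebra on matrices, hence on R^K = 'rV[R]_K. *)
Section borel_matrix.
Variables (R : realType) (p q : nat).

HB.instance Definition _ :=
  @isMeasurable.Build (sigma_display (@open 'M[R]_(p, q))) 'M[R]_(p, q)
    <<s (@open 'M[R]_(p, q)) >> (@sigma_algebra0 _ setT _)
    (@sigma_algebraC _ _) (@sigma_algebra_bigcup _ setT _).

End borel_matrix.

(* Probability measures on a finite set, given by their weights. *)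
Definition is_pmf (R : realType) (T : finType) (p : {ffun T -> R}) : Prop :=
  (forall t, 0 <= p t) /\ \sum_t p t = 1.

(* Pos i and Neg i stand for the signals i and -i. *)
Inductive signal (K : nat) : Type := Pos of 'I_K | Neg of 'I_K.

Definition index_of (K : nat) (y : signal K) : 'I_K :=
  match y with Pos i => i | Neg i => i end.

Definition hat (R : realType) (K : nat) (a : {ffun {set 'I_K} -> R})
    (y : signal K) : R :=
  match y with
  | Pos i => \sum_(j : {set 'I_K} | i \in j) a j
  | Neg i => \sum_(j : {set 'I_K} | i \notin j) a j
  end.

Definition e_ (R : realType) (K : nat) (j : {set 'I_K}) : 'rV[R]_K :=
  \sum_(i in j) delta_mx 0 i.

Definition translate (R : realType) (K : nat) (mu : set 'rV[R]_K -> \bar R)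
    (v : 'rV[R]_K) : set 'rV[R]_K -> \bar R :=
  pushforward mu (fun x => x + v).

Section one_round.
Variables (R : realType) (K : nat).
Variables (d : measure_display) (Omega : measurableType d).
Variable P : probability Omega R.
Variables (X : {RV P >-> 'rV[R]_K}) (I : Omega -> 'I_K)
          (J : Omega -> {set 'I_K}).

(* [K] and {0,1}^K carry the discrete sigma-algebra, so the measurability of I
   and J and the independence range over all subsets of these finite sets. *)
Record one_round_model (m : probability 'rV[R]_K R)
    (a : {ffun {set 'I_K} -> R}) (b : {ffun 'I_K -> R}) : Prop := {
  measurable_I : forall B : set 'I_K, measurable (I @^-1` B);
  measurable_J : forall C : set {set 'I_K}, measurable (J @^-1` C);
  law_X : forall A, measurable A -> distribution P X A = m A;
  law_I : forall i, P (I @^-1` [set i]) = (b i)%:E;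
  law_J : forall j, P (J @^-1` [set j]) = (a j)%:E;
  independent_XIJ : forall A (B : set 'I_K) (C : set {set 'I_K}),
    measurable A ->
    P (X @^-1` A `&` I @^-1` B `&` J @^-1` C) =
    (P (X @^-1` A) * P (I @^-1` B) * P (J @^-1` C))%E
}.

Definition DeltaX (w : Omega) : 'rV[R]_K :=
  e_ R (J w) - (if I w \in J w then e_ R [set: 'I_K] else 0).

Definition Y (w : Omega) : signal K :=
  if I w \in J w then Pos (I w) else Neg (I w).

End one_round.

(* Conditional law of Z given the event E; only meaningful if 0 < P E. *)
Definition cond_law (R : realType) (d d' : measure_display)
    (Omega : measurableType d) (T : measurableType d')
    (P : probability Omega R) (Z : Omega -> T) (E : set Omega) (A : set T) :
    \bar R :=
  (P (Z @^-1` A `&` E) * ((fine (P E))^-1)%:E)%E.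

(* "l is l(m, a, y)": l is the conditional law given {Y = y} in every
   realization of the model with b i > 0, whatever the underlying probability
   space and whatever b; delta_0 by convention when hat a y = 0. *)
Definition is_signal_law (R : realType) (K : nat)
    (m : probability 'rV[R]_K R) (a : {ffun {set 'I_K} -> R})
    (y : signal K) (l : probability 'rV[R]_K R) : Prop :=
  (0 < hat a y ->
    forall (b : {ffun 'I_K -> R}), is_pmf b -> 0 < b (index_of y) ->
    forall (d : measure_display) (Omega : measurableType d)
      (P : probability Omega R) (X : {RV P >-> 'rV[R]_K})
      (I : Omega -> 'I_K) (J : Omega -> {set 'I_K}),
    one_round_model X I J m a b ->
    let E := [set w | Y I J w = y] in
    (0 < P E)%E /\
    forall A, measurable A ->
      l A = cond_law P (fun w => X w + DeltaX R I J w) E A) /\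
  (hat a y = 0 -> forall A, measurable A -> l A = \d_(0 : 'rV[R]_K) A).

(* Main.v *)
(* On {Y = y} the event J = j forces X + DeltaX to be X plus a vector that
   depends only on j and on the sign of y, so independence splits
   P (X + DeltaX in A, Y = y) into the sum over the j compatible with y of
   b i * a j * m (A - shift j); dividing by P (Y = y) = b i * hat a y cancels
   b i. Since l is only specified through realizations of the model, the formula
   also needs one realization with b i > 0; it is built as a mixture of the images
   of m under x |-> (x, (i, j)), with weights b i * a j. *)
Require Import Defs.
From HB Require Import structures.
From mathcomp Require Import all_boot all_order all_algebra.
From mathcomp Require Import all_classical all_reals all_analysis.

Set Implicit Arguments.
Unset Strict Implicit.
Unset Printing Implicit Defensive.

Import Order.TTheory GRing.Theory Num.Theory.
Import numFieldNormedType.Exports.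

Local Open Scope classical_set_scope.
Local Open Scope ring_scope.

(** * Finite mixtures of probability measures *)

Section mixture.
Context d (T : measurableType d) (R : realType) (I : finType).
Variables (w : {ffun I -> R}) (mu : I -> probability T R).

Definition mixture (hw : is_pmf w) (A : set T) : \bar R :=
  (\sum_i (w i)%:E * mu i A)%E.

Variable hw : is_pmf w.

Let term_ge0 i A : (0 <= (w i)%:E * mu i A)%E.
Proof. by rewrite mule_ge0// lee_fin; case: hw. Qed.

Let mixture0 : mixture hw set0 = 0%E.
Proof. by rewrite /mixture big1// => i _; rewrite measure0 mule0. Qed.

Let mixture_ge0 A : (0 <= mixture hw A)%E.
Proof. by rewrite /mixture sume_ge0. Qed.

Let mixture_semi_sigma_additive : semi_sigma_additive (mixture hw).
Proof.
(* Partial sums of a nonnegative series always converge, so only the value of the limit has to be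
   identified; it comes from exchanging the series with the finite sum over [i]. *)
move=> F mF tF mUF; rewrite [X in _ --> X](_ : _ =
    limn (fun n => \sum_(0 <= k < n) mixture hw (F k))%E).
  by apply: is_cvg_ereal_nneg_natsum => k _; exact: mixture_ge0.
rewrite nneseries_sum//; apply: eq_bigr => i _.
rewrite nneseriesZl//; first by congr (_ * _)%E; exact: measure_semi_bigcup.
Qed.

HB.instance Definition _ := isMeasure.Build _ _ _ (mixture hw)
  mixture0 mixture_ge0 mixture_semi_sigma_additive.

Let mixture_setT : mixture hw setT = 1%E.
Proof.
rewrite /mixture (eq_bigr (fun i => (w i)%:E)).
  by rewrite sumEFin; case: hw => _ ->.
by move=> i _; rewrite probability_setT mule1.
Qed.

HB.instance Definition _ := Measure_isProbability.Build _ _ _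
  (mixture hw) mixture_setT.

End mixture.

(** Serves twice: with [x |-> (x, (i, j))] to realize the model, and with translations to build the
    claimed conditional law. *)
Lemma mixture_of_images d d' (T : measurableType d) (T' : measurableType d')
    (R : realType) (m : probability T R) (I : finType) (w : {ffun I -> R})
    (f : I -> T -> T') :
  is_pmf w -> (forall i, measurable_fun setT (f i)) ->
  exists Q : probability T' R,
    forall A, Q A = (\sum_i (w i)%:E * m (f i @^-1` A))%E.
Proof.
move=> hw mf.
pose F i : {mfun T >-> T'} :=
  HB.pack (f i) (isMeasurableFun.Build _ _ _ _ _ (mf i)).
by exists (mixture (fun i => distribution m (F i)) hw).
Qed.

(** Open sets generate the sigma-algebra, and their preimages are open by continuity. *)
Lemma measurable_translation (R : realType) (p q : nat) (v : 'M[R]_(p, q)) :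
  measurable_fun setT (fun x : 'M[R]_(p, q) => x + v).
Proof.
apply: (@measurability _ _ _ _ _ _ (@open 'M[R]_(p, q)) erefl) => _ [B oB <-].
rewrite setTI; apply: sub_sigma_algebra.
apply: open_comp => // x _.
apply: (@continuousD R _ _ idfun (cst v)); first exact: cvg_id.
exact: cst_continuous.
Qed.

(* A copy of T with the discrete sigma-algebra; t is the base point that
   measurable types must carry. *)
Definition discrete_at (T : Type) (t : T) : Type := T.

Section discrete_at.
Variables (T : choiceType) (t : T).
HB.instance Definition _ := Choice.on (discrete_at t).
HB.instance Definition _ := isPointed.Build (discrete_at t) t.
HB.instance Definition _ := @isMeasurable.Build default_measure_display
  (discrete_at t) discrete_measurable discrete_measurable0
  discrete_measurableC discrete_measurableU.
End discrete_at.

(** * A realization of the one-round model *)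

Section realization.
Local Open Scope ereal_scope.
Variables (R : realType) (K : nat) (m : probability 'rV[R]_K R).
Variables (a : {ffun {set 'I_K} -> R}) (b : {ffun 'I_K -> R}).
Hypotheses (ha : is_pmf a) (hb : is_pmf b).

Let w : {ffun 'I_K * {set 'I_K} -> R} := [ffun t => b t.1 * a t.2]%R.

Let w_pmf : is_pmf w.
Proof.
case: ha hb => a0 a1 [b0 b1]; split; first by move=> t; rewrite ffunE mulr_ge0.
rewrite -b1 (eq_bigr (fun t : 'I_K * {set 'I_K} => b t.1 * a t.2)%R).
  rewrite -(pair_bigA _ (fun i j => b i * a j)%R)/=.
  by apply: eq_bigr => i _; rewrite -mulr_sumr a1 mulr1.
by move=> t _; rewrite ffunE.
Qed.

(** The sample space is the product of ['rV[R]_K] with the discrete space of pairs [(i, j)], and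
    [X], [I], [J] are the coordinates. The index [i0] supplies the base point of the discrete
    factor. *)
Lemma one_round_model_exists (i0 : 'I_K) :
  exists (d : measure_display) (Omega : measurableType d)
    (P : probability Omega R) (X : {RV P >-> 'rV[R]_K})
    (I : Omega -> 'I_K) (J : Omega -> {set 'I_K}), one_round_model X I J m a b.
Proof.
pose S := discrete_at (i0, finset.set0 : {set 'I_K}).
have mpair (t : 'I_K * {set 'I_K}) :
    measurable_fun setT (fun x : 'rV[R]_K => (x, t : S)).
  exact: pair2_measurable.
have [P PE] := mixture_of_images m w_pmf mpair.
pose X : {RV P >-> 'rV[R]_K} :=
  HB.pack fst (isMeasurableFun.Build _ _ ('rV[R]_K * S)%type _ fst measurable_fst).
pose I (u : 'rV[R]_K * S) : 'I_K := (u.2 : 'I_K * {set 'I_K}).1.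
pose J (u : 'rV[R]_K * S) : {set 'I_K} := (u.2 : 'I_K * {set 'I_K}).2.
(* Masses of [B] under [b] and of [C] under [a], written with indicators so that their product
   expands into a sum over all pairs, as in the mixture. *)
pose wI (B : set 'I_K) := (\sum_i b i * (i \in B)%:R)%R.
pose wJ (C : set {set 'I_K}) := (\sum_j a j * (j \in C)%:R)%R.
have wIT : wI setT = 1%R.
  by rewrite -(proj2 hb); apply: eq_bigr => i _; rewrite in_setT mulr1.
have wJT : wJ setT = 1%R.
  by rewrite -(proj2 ha); apply: eq_bigr => j _; rewrite in_setT mulr1.
(* Putting [setT] in two of the three slots of this formula yields the marginals, hence both the
   laws and the independence. *)
have PXIJ A B C : measurable A ->
      P (X @^-1` A `&` I @^-1` B `&` J @^-1` C) =
      m A * (wI B)%:E * (wJ C)%:E.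
  move=> mA; rewrite PE.
  (* Passing to real numbers makes distributivity free of side conditions. *)
  have -> : m A = (fine (m A))%:E by rewrite fineK ?fin_num_measure.
  rewrite -!EFinM -mulrA mulr_suml mulr_sumr.
  under [in RHS]eq_bigr => i _ do rewrite !mulr_sumr.
  rewrite pair_bigA/= -sumEFin; apply: eq_bigr => -[i j] _ /=.
  rewrite ffunE/= /I /J /=.
  have -> : (fun x => (x, (i, j) : S)) @^-1`
      (X @^-1` A `&` I @^-1` B `&` J @^-1` C) = if (i \in B) && (j \in C) then A else set0.
    rewrite /I /J; apply/seteqP; split => x /=.
      by move=> [[Ax Bi] Cj]; rewrite !mem_set.
    by case: ifPn => // /andP[/set_mem Bi /set_mem Cj] Ax.
  case: (i \in B); case: (j \in C); rewrite ?measure0 ?mule0 ?mulr0 ?mul0r ?mulr0//=.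
  by rewrite -[in LHS](@fineK _ (m A)) ?fin_num_measure// -EFinM !mulr1 mulrC.
have PX A : measurable A -> P (X @^-1` A) = m A.
  move=> mA; have := PXIJ A setT setT mA.
  by rewrite !preimage_setT !setIT wIT wJT !mule1.
have PI B : P (I @^-1` B) = (wI B)%:E.
  have := PXIJ setT B setT measurableT.
  by rewrite !preimage_setT setIT setTI wJT mule1 probability_setT mul1e.
have PJ C : P (J @^-1` C) = (wJ C)%:E.
  have := PXIJ setT setT C measurableT.
  by rewrite !preimage_setT !setTI wIT mule1 probability_setT mul1e.
exists _, _, P, X, I, J; split.
- move=> B.
  have -> : I @^-1` B = setT `*` ([set t | B t.1] : set S).
    by apply/seteqP; split => // -[x t] [].
  exact: measurableX.
- move=> C.
  have -> : J @^-1` C = setT `*` ([set t | C t.2] : set S).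
    by apply/seteqP; split => // -[x t] [].
  exact: measurableX.
- exact: PX.
- move=> i; rewrite PI /wI (bigD1 i)//= big1 ?addr0.
    by rewrite mem_set// mulr1.
  by move=> k /eqP ki; rewrite memNset// mulr0.
- move=> j; rewrite PJ /wJ (bigD1 j)//= big1 ?addr0.
    by rewrite mem_set// mulr1.
  by move=> k /eqP kj; rewrite memNset// mulr0.
- by move=> A B C mA; rewrite PXIJ// PX// PI PJ.
Qed.

End realization.

(** * Signals, displacements and the claimed law *)

Definition compatible (K : nat) (y : signal K) (j : {set 'I_K}) : bool :=
  match y with Pos i => i \in j | Neg i => i \notin j end.

(** The value of [DeltaX] when [Y = y] and [J = j]; for [Pos] it is the difference of [e_ R j] and
    the all-ones vector. *)
Definition displacement (R : realType) (K : nat) (y : signal K)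
    (j : {set 'I_K}) : 'rV[R]_K :=
  match y with Pos _ => - e_ R (~: j) | Neg _ => e_ R j end.

(** Both right-hand sides of the theorem at once: they are its instances at [Pos i] and [Neg i]. *)
Definition posterior (R : realType) (K : nat) (m : probability 'rV[R]_K R)
    (a : {ffun {set 'I_K} -> R}) (y : signal K) (A : set 'rV[R]_K) : \bar R :=
  (\sum_(j : {set 'I_K} | compatible y j)
    translate (fun B => (a j / hat a y)%:E * m B) (displacement R y j) A)%E.

Lemma hatE (R : realType) (K : nat) (a : {ffun {set 'I_K} -> R}) y :
  hat a y = \sum_(j : {set 'I_K} | compatible y j) a j.
Proof. by case: y. Qed.

Lemma hat_ge0 (R : realType) (K : nat) (a : {ffun {set 'I_K} -> R}) y :
  is_pmf a -> 0 <= hat a y.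
Proof. by case=> a0 _; rewrite hatE sumr_ge0. Qed.

Lemma e_setC (R : realType) (K : nat) (j : {set 'I_K}) :
  e_ R j - e_ R [set: 'I_K] = - e_ R (~: j).
Proof.
have -> : e_ R [set: 'I_K] = e_ R j + e_ R (~: j).
  rewrite /e_ (bigID (mem j))/=; congr (_ + _).
    by apply: eq_bigl => i; rewrite inE.
  by apply: eq_bigl => i; rewrite !inE.
by rewrite opprD addrA subrr sub0r.
Qed.

(** Separates the signal event into a condition on [I] and one on [J], the form in which
    independence applies. *)
Lemma Y_eqP (K : nat) d (T : measurableType d) (I : T -> 'I_K) (J : T -> {set 'I_K}) y w :
  Y I J w = y <-> I w = index_of y /\ compatible y (J w).
Proof.
rewrite /Y; case: ifPn => IJ; case: y => i /=; split=> //.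
- by case=> <-.
- by case=> ->.
- by case=> Ii; rewrite -Ii IJ.
- by case=> Ii; rewrite -Ii (negbTE IJ).
- by case=> <-.
- by case=> ->.
Qed.

Lemma DeltaX_displacement (R : realType) (K : nat) d (T : measurableType d)
    (I : T -> 'I_K) (J : T -> {set 'I_K}) w :
  DeltaX R I J w = displacement R (Y I J w) (J w).
Proof.
by rewrite /DeltaX /Y; case: ifP => _ /=; rewrite ?e_setC ?subr0.
Qed.

(** Finite additivity in big-operator form: the finitely supported sum is listed along the
    enumeration of [I] filtered by [P]. *)
Lemma measure_bigcup_fintype d (T : measurableType d) (R : realType)
    (mu : {measure set T -> \bar R}) (I : finType) (P : pred I)
    (F : I -> set T) :
  (forall i, P i -> measurable (F i)) -> trivIset [set` P] F ->
  mu (\bigcup_(i in [set` P]) F i) = (\sum_(i | P i) mu (F i))%E.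
Proof.
move=> mF tF; rewrite measure_fin_bigcup//.
rewrite -[RHS]big_filter [RHS]fsbig_seq ?filter_uniq ?index_enum_uniq//.
apply: eq_fsbigl; apply/seteqP.
by split => i /=; rewrite mem_filter mem_index_enum andbT.
Qed.

(** * The conditional law in an arbitrary realization *)

Section one_round_law.
Local Open Scope ereal_scope.
Context (R : realType) (K : nat) d (Omega : measurableType d).
Variables (P : probability Omega R) (X : {RV P >-> 'rV[R]_K}).
Variables (I : Omega -> 'I_K) (J : Omega -> {set 'I_K}).
Variables (m : probability 'rV[R]_K R).
Variables (a : {ffun {set 'I_K} -> R}) (b : {ffun 'I_K -> R}).
Hypothesis model : one_round_model X I J m a b.
Variable y : signal K.

Lemma signal_event_law (A : set 'rV[R]_K) : measurable A ->
  P ((fun w => X w + DeltaX R I J w)%R @^-1` A `&` [set w | Y I J w = y]) =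
  \sum_(j | compatible y j)
    (b (index_of y) * a j)%:E * m ((fun x => x + displacement R y j)%R @^-1` A).
Proof.
move=> mA.
pose S j := (fun x : 'rV[R]_K => x + displacement R y j)%R @^-1` A.
have mS j : measurable (S j).
  by rewrite -[S j]setTI; exact: measurable_translation.
(* Each [F j] is a rectangle in [(X, I, J)]; they are pairwise disjoint because [J] takes a single
   value at each point. *)
pose F j := X @^-1` S j `&` I @^-1` [set index_of y] `&` J @^-1` [set j].
have -> : (fun w => X w + DeltaX R I J w)%R @^-1` A `&` [set w | Y I J w = y]
    = \bigcup_(j in [set` compatible y]) F j.
  apply/seteqP; split => w /=.
    move=> [Aw yw]; have /Y_eqP[Iy yJ] := yw.
    exists (J w) => //; split => //; split => //.
    by rewrite /S /= -yw -DeltaX_displacement.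
  move=> [j yj [[/= Sw Iw] /= Jw]]; rewrite -Jw in yj Sw.
  have yw : Y I J w = y by apply/Y_eqP.
  by split => //; rewrite DeltaX_displacement yw.
rewrite measure_bigcup_fintype.
- apply: eq_bigr => j _.
  rewrite [LHS](independent_XIJ model [set index_of y] [set j] (mS j)) (law_I model) (law_J model) EFinM.
  have -> : P (X @^-1` S j) = m (S j) by exact: (law_X model).
  by rewrite [RHS]muleC muleA.
- move=> j _; apply: measurableI; last exact: (measurable_J model).
  apply: measurableI; last exact: (measurable_I model).
  by rewrite -[X @^-1` _]setTI; exact: measurable_funPT.
- by move=> j k _ _ [w [[_ /= <-] [_ /= <-]]].
Qed.

Lemma signal_prob :
  P [set w | Y I J w = y] = (b (index_of y) * hat a y)%:E.
Proof.
have := signal_event_law measurableT; rewrite preimage_setT setTI => ->.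
rewrite hatE mulr_sumr -sumEFin; apply: eq_bigr => j _.
by rewrite preimage_setT probability_setT mule1.
Qed.

Lemma cond_law_posterior (A : set 'rV[R]_K) :
  (0 < hat a y)%R -> (0 < b (index_of y))%R -> measurable A ->
  cond_law P (fun w => X w + DeltaX R I J w)%R [set w | Y I J w = y] A
  = posterior m a y A.
Proof.
move=> hy by0 mA.
rewrite /cond_law signal_event_law// signal_prob/=.
have mS j : measurable ((fun x : 'rV[R]_K => x + displacement R y j)%R @^-1` A).
  by rewrite -[_ @^-1` _]setTI; exact: measurable_translation.
rewrite ge0_sume_distrl.
  apply: eq_bigr => j _; rewrite /translate /pushforward.
  rewrite muleAC -EFinM; congr (_%:E * _).
  by rewrite invfM mulrACA mulfV ?gt_eqF// mul1r.
(* Distributing the inverse over the sum requires nonnegative terms; [a j] is nonnegative as the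
   probability of [J = j]. *)
have aj0 j : (0 <= a j)%R by rewrite -lee_fin -(law_J model) measure_ge0.
by move=> j _; rewrite mule_ge0// lee_fin mulr_ge0// ltW.
Qed.

End one_round_law.

(** * Existence of the laws and their formulas *)

Lemma posterior_exists (R : realType) (K : nat) (m : probability 'rV[R]_K R)
    (a : {ffun {set 'I_K} -> R}) (y : signal K) :
  is_pmf a -> 0 < hat a y ->
  exists Q : probability 'rV[R]_K R, forall A, Q A = posterior m a y A.
Proof.
move=> [a0 a1] hy.
(* Extending the weights by 0 to incompatible subsets gives total mass [hat a y / hat a y = 1], so
   the claimed law is a mixture of translates of [m]. *)
pose w := [ffun j => if compatible y j then a j / hat a y else 0].
have hw : is_pmf w.
  split=> [j|].
    by rewrite ffunE; case: ifP => // _; rewrite divr_ge0// ltW.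
  under eq_bigr do rewrite ffunE.
  by rewrite -big_mkcond/= -mulr_suml -hatE mulfV ?gt_eqF.
have [Q QE] := mixture_of_images m hw
  (fun j => @measurable_translation R 1 K (displacement R y j)).
exists Q => A; rewrite QE /posterior [RHS]big_mkcond/=; apply: eq_bigr => j _.
by rewrite ffunE; case: ifP => // _; rewrite mul0e.
Qed.

Theorem proposition2p1 (R : realType) (K : nat) (hK : (2 <= K)%N)
    (a : {ffun {set 'I_K} -> R}) (ha : is_pmf a)
    (m : probability 'rV[R]_K R) :
  (exists l : signal K -> probability 'rV[R]_K R,
     forall y, is_signal_law m a y (l y)) /\
  (forall l : signal K -> probability 'rV[R]_K R,
     (forall y, is_signal_law m a y (l y)) ->
     forall i : 'I_K,
       (0 < hat a (Pos i) ->
        forall A : set 'rV[R]_K, measurable A ->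
          l (Pos i) A =
          (\sum_(j : {set 'I_K} | i \in j)
             translate (fun B => (a j / hat a (Pos i))%:E * m B)
               (- e_ R (~: j)) A)%E) /\
       (0 < hat a (Neg i) ->
        forall A : set 'rV[R]_K, measurable A ->
          l (Neg i) A =
          (\sum_(j : {set 'I_K} | i \notin j)
             translate (fun B => (a j / hat a (Neg i))%:E * m B)
               (e_ R j) A)%E) /\
       (hat a (Pos i) = 0 -> forall A : set 'rV[R]_K, measurable A ->
          l (Pos i) A = \d_(0 : 'rV[R]_K) A) /\
       (hat a (Neg i) = 0 -> forall A : set 'rV[R]_K, measurable A ->
          l (Neg i) A = \d_(0 : 'rV[R]_K) A)).
Proof.
split.
  suff law y : exists Q : probability 'rV[R]_K R, is_signal_law m a y Q.
    by have [l ?] := choice law; exists l.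
  have := hat_ge0 y ha; rewrite le_eqVlt => /orP[/eqP hy|hy].
    (* With [hat a y = 0] the conditional clause is vacuous and only the convention remains. *)
    by exists \d_(0 : 'rV[R]_K); split => //; rewrite -hy ltxx.
  have [Q QE] := posterior_exists m ha hy.
  exists Q; split; last by move=> hy0; rewrite hy0 ltxx in hy.
  move=> _ b _ by0 d Omega P X I J model; split.
    by rewrite (signal_prob model) lte_fin mulr_gt0.
  by move=> A mA; rewrite QE (cond_law_posterior model).
move=> l lawl i.
have l_posterior y : 0 < hat a y -> forall A, measurable A ->
    l y A = posterior m a y A.
  move=> hy A mA.
  (* The point mass at the index of [y] is a convenient law of [I] charging that index; evaluating
     [l] in one realization with this [b] determines it. *)
  pose b : {ffun 'I_K -> R} := [ffun k => (k == index_of y)%:R].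
  have hb : is_pmf b.
    split=> [k|]; first by rewrite ffunE ler0n.
    rewrite (bigD1 (index_of y))//= big1 ?addr0 ?ffunE ?eqxx//.
    by move=> k /negbTE ki; rewrite ffunE ki.
  have by0 : 0 < b (index_of y) by rewrite ffunE eqxx ltr01.
  have [dO [Om [PO [XO [IO [JO model]]]]]] :=
    one_round_model_exists m ha hb i.
  have [_ lE] := (lawl y).1 hy b hb by0 _ _ _ _ _ _ model.
  by rewrite lE// (cond_law_posterior model).
by split; [|split; [|split]];
  [exact: l_posterior|exact: l_posterior|exact: (lawl _).2|exact: (lawl _).2].
Qed.
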